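(* Let $b\ge 2$ be an integer. If $m$ and $n$ are dismal numbers in base $b$ and $g$ is a base $b$ digit map, then $$g(m\oplus_b n)=g(m)\oplus_b g(n),\qquad g(m\otimes_b n)=g(m)\otimes_b g(n).$$
   Context: A base $b$ dismal number is a digit string $n=n_{k-1}\ldots n_1n_0|_b$ with digits $n_i\in\{0,1,\ldots,b-1\}$, identified with the nonnegative integer $\sum_i n_ib^i$; its length is $k$. For $m=m_{k-1}\ldots m_0|_b$ of length $k$ and $n=n_{l-1}\ldots n_0|_b$ of length $l$: the dismal sum $m\oplus_b n$ has length $\max\{k,l\}$ and $i$-th digit $\max\{m_i,n_i\}$ (a missing digit being $0$); the dismal product $m\otimes_b n$ has length $k+l-1$ and $i$-th digit $\max\{\min\{m_j,n_{i-j}\}:0\le j\le k-1,\ 0\le i-j\le l-1\}$ for $0\le i\le k+l-2$. A base $b$ digit map is a nondecreasing function $g:\{0,1,\ldots,b-1\}\to\{0,1,\ldots,b-1\}$ (i.e. $x\le y$ implies $g(x)\le g(y)$), not necessarily one-to-one or onto. For $n=n_{k-1}\ldots n_0|_b$ one sets $g(n):=g(n_{k-1})\ldots g(n_1)g(n_0)|_b$; here $g$ is applied to each of the digits of the string, and a dismal sum or product is regarded as a digit string of length $\max\{k,l\}$, respectively $k+l-1$. *)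

(* Defs.v *)
From HB Require Import structures.
From mathcomp Require Import all_boot.

Set Implicit Arguments.
Unset Strict Implicit.
Unset Printing Implicit Defensive.

(* Digits are stored least significant first: the i-th item of [digits n] is
   the digit n_i of weight b ^ i. Leading zeros are allowed and significant:
   equality on [dismal b] is equality of digit strings, lengths included
   (which implies equality of the represented integers). A digit map need not
   fix 0, so its action is only meaningful on strings. *)
Record dismal (b : nat) := Dismal {
  digits : seq 'I_b;
  size_digits_gt0 : 0 < size digits
}.

HB.instance Definition _ (b : nat) := [isSub for @digits b].
HB.instance Definition _ (b : nat) := [Equality of dismal b by <:].

Section Operations.
Variable b : nat.
Implicit Types (m n : dismal b) (g : 'I_b -> 'I_b).

Definition dlength n : nat := size (digits n).

(* Numerical value of the i-th digit, 0 if i >= dlength n. *)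
Definition digit n (i : nat) : nat := nth 0 (map val (digits n)) i.

Lemma base_gt0 n : 0 < b.
Proof. by case: n => [[|d s] //= _]; apply: leq_ltn_trans (ltn_ord d). Qed.

Lemma ltn_digit n i : digit n i < b.
Proof.
have [lt_in|le_ni] := ltnP i (size (map val (digits n))).
  by have /mapP[d _ def_d] := mem_nth 0 lt_in; rewrite /digit def_d ltn_ord.
by rewrite /digit nth_default // (base_gt0 n).
Qed.

Definition dadd_digit m n (i : nat) : nat := maxn (digit m i) (digit n i).

Definition dmul_digit m n (i : nat) : nat :=
  \max_(j < dlength m | (j <= i) && (i - j < dlength n))
    minn (digit m j) (digit n (i - j)).

Lemma dadd_digit_lt m n i : dadd_digit m n i < b.
Proof. by rewrite gtn_max !ltn_digit. Qed.

Lemma dmul_digit_lt m n i : dmul_digit m n i < b.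
Proof.
rewrite /dmul_digit; elim/big_ind: _ => [|x y ltx lty|j _].
- exact: base_gt0 n.
- by rewrite gtn_max ltx lty.
- by rewrite gtn_min ltn_digit.
Qed.

Definition dadd_digits m n : seq 'I_b :=
  mkseq (fun i => Ordinal (dadd_digit_lt m n i)) (maxn (dlength m) (dlength n)).

Definition dmul_digits m n : seq 'I_b :=
  mkseq (fun i => Ordinal (dmul_digit_lt m n i)) (dlength m + dlength n - 1).

Lemma size_dadd_gt0 m n : 0 < size (dadd_digits m n).
Proof. by rewrite size_mkseq leq_max /dlength size_digits_gt0. Qed.

Lemma size_dmul_gt0 m n : 0 < size (dmul_digits m n).
Proof.
rewrite size_mkseq subn_gt0 -addn1.
by apply: leq_add; apply: size_digits_gt0.
Qed.

Lemma size_map_digits_gt0 g n : 0 < size (map g (digits n)).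
Proof. by rewrite size_map size_digits_gt0. Qed.

Definition dadd m n : dismal b := Dismal (size_dadd_gt0 m n).

Definition dmul m n : dismal b := Dismal (size_dmul_gt0 m n).

Definition digit_map g : Prop := forall x y : 'I_b, x <= y -> g x <= g y.

Definition dmap g n : dismal b := Dismal (size_map_digits_gt0 g n).

End Operations.

(* Main.v *)
Require Import Defs.
From mathcomp Require Import all_boot.

(** A nondecreasing function on a chain commutes with binary minima and maxima,
    and with the maximum of any nonempty finite family. Dismal sums and products
    are built digit by digit from exactly these operations, so a digit map
    respects them once two points about missing digits and empty maxima are
    settled, both coming from the fact that a digit map need not fix 0.

    For the sum, in a position where only one string has a digit, the other
    contributes 0 before and after the digit map is applied, and 0 is neutral for
    the maximum: the digit map is evaluated only at the digit that is present.

    For the product, the maximum of an empty family is 0, which would not be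
    preserved; but every position of the product lies below k + l - 1, where k
    and l are the lengths of the factors, so at least one pair of digits
    contributes to it ([dmul_index_exists]).

    Digits are computed as natural numbers, so the digit map is extended to a
    nondecreasing function on all natural numbers ([digit_ext]); commutation
    is proved for the extension, without any bound on its arguments. *)

Section MonotoneMax.
Variables (f : nat -> nat) (f_homo : {homo f : x y / x <= y}).

Lemma homo_maxn : {morph f : x y / maxn x y}.
Proof.
move=> x y; case/orP: (leq_total x y) => [le_xy|le_yx].
  by rewrite (maxn_idPr le_xy) (maxn_idPr (f_homo _ _ le_xy)).
by rewrite (maxn_idPl le_yx) (maxn_idPl (f_homo _ _ le_yx)).
Qed.

Lemma homo_minn : {morph f : x y / minn x y}.
Proof.
move=> x y; case/orP: (leq_total x y) => [le_xy|le_yx].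
  by rewrite (minn_idPl le_xy) (minn_idPl (f_homo _ _ le_xy)).
by rewrite (minn_idPr le_yx) (minn_idPr (f_homo _ _ le_yx)).
Qed.

(** The index [i0] is what makes the family nonempty: an empty maximum is 0 on
    both sides of the equation, which [f] need not fix. *)
Lemma homo_bigmax (I : finType) (P : pred I) (F : I -> nat) (i0 : I) :
  P i0 -> f (\max_(i | P i) F i) = \max_(i | P i) f (F i).
Proof.
move=> Pi0.
(* The spurious term f 0 makes the induction work from the empty family on;
   it is then absorbed by the term of index i0. *)
have -> : f (\max_(i | P i) F i) = maxn (f 0) (\max_(i | P i) f (F i)).
  elim/big_rec2: _ => [|i y x _ fx]; first by rewrite maxn0.
  by rewrite homo_maxn fx maxnCA.
apply/maxn_idPr/(leq_trans (f_homo _ _ (leq0n (F i0)))).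
exact: (leq_bigmax_cond (F := fun i => f (F i))).
Qed.

End MonotoneMax.

Section DigitMap.
Variable b : nat.
Implicit Types (m n p q : dismal b).

Lemma digit_default n i : dlength n <= i -> digit n i = 0.
Proof. by move=> le_ni; rewrite /digit nth_default ?size_map. Qed.

Lemma dlength_dmap (g : 'I_b -> 'I_b) n : dlength (dmap g n) = dlength n.
Proof. exact: size_map. Qed.

Lemma dlength_dadd m n : dlength (dadd m n) = maxn (dlength m) (dlength n).
Proof. exact: size_mkseq. Qed.

Lemma dlength_dmul m n : dlength (dmul m n) = dlength m + dlength n - 1.
Proof. exact: size_mkseq. Qed.

Lemma digit_dadd m n i : i < maxn (dlength m) (dlength n) ->
  digit (dadd m n) i = dadd_digit m n i.
Proof. by move=> lt_i; rewrite /digit /= -map_comp (nth_map 0) ?size_iota // nth_iota. Qed.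

Lemma digit_dmul m n i : i < dlength m + dlength n - 1 ->
  digit (dmul m n) i = dmul_digit m n i.
Proof. by move=> lt_i; rewrite /digit /= -map_comp (nth_map 0) ?size_iota // nth_iota. Qed.

Lemma eq_dismal p q : dlength p = dlength q ->
  (forall i, i < dlength p -> digit p i = digit q i) -> p = q.
Proof.
move=> eq_len eq_dig; apply/val_inj/(inj_map val_inj).
by apply: (@eq_from_nth _ 0) => [|i]; rewrite !size_map //; apply: eq_dig.
Qed.

(** The largest admissible index is a witness: it is [i] when [i] is a position
    of [m], and the last position of [m] otherwise. *)
Lemma dmul_index_exists m n i : i < dlength m + dlength n - 1 ->
  exists j : 'I_(dlength m), (j <= i) && (i - j < dlength n).
Proof.
move=> lt_i; have n_gt0 : 0 < dlength n := size_digits_gt0 n.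
have [lt_im|le_mi] := ltnP i (dlength m).
  by exists (Ordinal lt_im); rewrite /= leqnn subnn.
have m_gt0 : 0 < dlength m := size_digits_gt0 m.
have lt_m : (dlength m).-1 < dlength m by rewrite ltn_predL.
exists (Ordinal lt_m); rewrite /= (leq_trans (leq_pred _) le_mi) /=.
have le_i : (dlength m).-1 <= i := leq_trans (leq_pred _) le_mi.
rewrite -(ltn_add2l (dlength m).-1) subnKC //.
by move: lt_i; rewrite -{1}(prednK m_gt0) addSn subn1.
Qed.

(** A running maximum is nondecreasing on the whole of [nat], also beyond the
    last digit, and returns the values of [g] when [g] is itself nondecreasing. *)
Definition digit_ext (g : 'I_b -> 'I_b) (x : nat) : nat :=
  \max_(d < b | d <= x) g d.

Lemma digit_ext_homo g : {homo digit_ext g : x y / x <= y}.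
Proof.
move=> x y le_xy; apply/bigmax_leqP => d le_dx.
exact: (leq_bigmax_cond (F := fun d => val (g d)) d (leq_trans le_dx le_xy)).
Qed.

Variables (g : 'I_b -> 'I_b) (hg : digit_map g).
Local Notation G := (digit_ext g).

Lemma digit_ext_val (d : 'I_b) : G d = g d.
Proof.
apply/eqP; rewrite eqn_leq (leq_bigmax_cond (F := fun e => val (g e))) // andbT.
by apply/bigmax_leqP => e; apply: hg.
Qed.

Lemma digit_dmap n i : i < dlength n -> digit (dmap g n) i = G (digit n i).
Proof.
move=> lt_in; have d0 : 'I_b := Ordinal (ltn_digit n i).
by rewrite /digit /= -map_comp !(nth_map d0) //= digit_ext_val.
Qed.

Lemma dmap_dadd m n : dmap g (dadd m n) = dadd (dmap g m) (dmap g n).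
Proof.
apply: eq_dismal => [|i].
  by rewrite dlength_dmap !dlength_dadd !dlength_dmap.
rewrite dlength_dmap => lt_i; rewrite digit_dmap //.
rewrite dlength_dadd in lt_i; rewrite !digit_dadd ?dlength_dmap // /dadd_digit.
have [lt_im|le_mi] := ltnP i (dlength m); last first.
  have lt_in : i < dlength n by move: lt_i; rewrite leq_max ltnNge le_mi.
  by rewrite !(digit_default m, digit_default (dmap g m)) ?dlength_dmap //
             !max0n digit_dmap.
have [lt_in|le_ni] := ltnP i (dlength n).
  by rewrite (homo_maxn _ (digit_ext_homo g)) !digit_dmap.
by rewrite !(digit_default n, digit_default (dmap g n)) ?dlength_dmap //
           !maxn0 digit_dmap.
Qed.

Lemma dmap_dmul m n : dmap g (dmul m n) = dmul (dmap g m) (dmap g n).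
Proof.
apply: eq_dismal => [|i].
  by rewrite dlength_dmap !dlength_dmul !dlength_dmap.
rewrite dlength_dmap => lt_i; rewrite digit_dmap //.
rewrite dlength_dmul in lt_i; rewrite !digit_dmul ?dlength_dmap // /dmul_digit.
have [j0 j0P] := dmul_index_exists _ _ _ lt_i.
rewrite (homo_bigmax _ (digit_ext_homo g) _ _ _ j0 j0P) !dlength_dmap.
apply: eq_bigr => j /andP[_ lt_ijn].
by rewrite (homo_minn _ (digit_ext_homo g)) !digit_dmap.
Qed.

End DigitMap.

Theorem theorem3 (b : nat) (hb : 2 <= b) (m n : dismal b) (g : 'I_b -> 'I_b)
    (hg : digit_map g) :
  dmap g (dadd m n) = dadd (dmap g m) (dmap g n) /\
  dmap g (dmul m n) = dmul (dmap g m) (dmap g n).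
Proof. by split; [apply: dmap_dadd | apply: dmap_dmul]. Qed.
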